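(* Let $(M,g,\nabla)$ be a statistical manifold with conjugate connection $\overline{\nabla}$, Levi-Civita connection $\nabla^g$ of $g$, and Tchebychev vector field $T=\mathrm{tr}_g(\nabla-\nabla^g)$. Let $\tau_2(\mathrm{id})=\tau_2^{(g,\nabla,g,\nabla^g)}(\mathrm{id})$ be the statistical bi-tension field of the identity map $\mathrm{id}:(M,g,\nabla)\to(M,g,\nabla^g)$, and let $\overline{\tau}_2(\mathrm{id})=\tau_2^{(g,\overline{\nabla},g,\nabla^g)}(\mathrm{id})$ be the statistical bi-tension field of the identity map $\mathrm{id}:(M,g,\overline{\nabla})\to(M,g,\nabla^g)$. Then $\tau_2(\mathrm{id})=\overline{\tau}_2(\mathrm{id})=0$ holds on $M$ if and only if both of the following equations hold on $M$: $$\Delta_g T+\sum_{i=1}^m\mathrm{Ric}^g(e_i,T)e_i=0,\qquad \mathrm{div}^g(T)\,T+\nabla^g_TT=0,$$ where $\{e_1,\dots,e_m\}$ is a (local) orthonormal frame with respect to $g$.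
   Context: All objects are smooth; manifolds $M$ are orientable of dimension $m\ge 2$. A statistical manifold $(M,g,\nabla)$ is a manifold with a Riemannian metric $g$ and a torsion-free affine connection $\nabla$ satisfying $(\nabla_Xg)(Y,Z)=(\nabla_Yg)(X,Z)$ for all vector fields $X,Y,Z$. $\nabla^g$ is the Levi-Civita connection of $g$ (and $(M,g,\nabla^g)$ is itself a statistical manifold). Set $K(X,Y)=K_XY=\nabla_XY-\nabla^g_XY$. The conjugate connection $\overline{\nabla}$ is defined by $Xg(Y,Z)=g(\nabla_XY,Z)+g(Y,\overline{\nabla}_XZ)$; then $(M,g,\overline{\nabla})$ is also a statistical manifold and $\overline{\nabla}_XY=\nabla^g_XY-K(X,Y)$. The Tchebychev vector field is $T=\mathrm{tr}_gK=\sum_iK(e_i,e_i)$ for an orthonormal frame $\{e_i\}$. Curvature: $R^\nabla(X,Y)Z=\nabla_X\nabla_YZ-\nabla_Y\nabla_XZ-\nabla_{[X,Y]}Z$. The tensor $L=L^{(g,\nabla)}$ is defined by $g(L(Z,W)X,Y)=g(R^\nabla(X,Y)Z,W)$. $R^g=R^{\nabla^g}$ and $\mathrm{Ric}^g(X,Y)=\sum_ig(R^g(e_i,X)Y,e_i)$. $\mathrm{div}^g$ is the divergence with respect to $g$, and $\Delta_g$ on vector fields is the rough Laplacian $\Delta_gV=\sum_i(\nabla^g_{e_i}\nabla^g_{e_i}V-\nabla^g_{\nabla^g_{e_i}e_i}V)$. For a map $u:(M,g,\nabla^M)\to(N,h,\nabla^N)$ between statistical manifolds with conjugate connections $\overline{\nabla}^M,\overline{\nabla}^N$,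 let $\nabla^u,\overline{\nabla}^u$ be the connections on $u^{-1}TN$ induced from $\nabla^N,\overline{\nabla}^N$. The tension field is $\tau(u)=\sum_i(\nabla^u_{e_i}u_*e_i-u_*\nabla^M_{e_i}e_i)\in\Gamma(u^{-1}TN)$. Let $\overline{\Delta}^u\xi=\sum_i\big(\overline{\nabla}^u_{e_i}\overline{\nabla}^u_{e_i}\xi-\overline{\nabla}^u_{\overline{\nabla}^M_{e_i}e_i}\xi\big)$ for $\xi\in\Gamma(u^{-1}TN)$. With $K^M,K^N$ the tensors $K$ of source and target and $L^N=L^{(h,\nabla^N)}$, the statistical bi-tension field of $u$ is $$\tau_2^{(g,\nabla^M,h,\nabla^N)}(u)=\overline{\Delta}^u\tau(u)+\mathrm{div}^g(\mathrm{tr}_gK^M)\,\tau(u)-\sum_{i=1}^mL^N(u_*e_i,\tau(u))u_*e_i-K^N(\tau(u),\tau(u)).$$ *)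

(* Defs.v *)
From HB Require Import structures.
From mathcomp Require Import all_boot all_order all_algebra.
From mathcomp Require Import all_classical all_reals all_analysis.

Set Implicit Arguments.
Unset Strict Implicit.
Unset Printing Implicit Defensive.

Import Order.TTheory GRing.Theory Num.Theory.
Import numFieldNormedType.Exports.

Local Open Scope classical_set_scope.
Local Open Scope ring_scope.

(** * Smooth maps between open subsets of normed spaces *)

(* [Ck k U f] is meant for open [U] and finite-dimensional [V]. *)
Fixpoint Ck (R : realType) (V W : normedModType R) (k : nat) (U : set V)
    (f : V -> W) : Prop :=
  if k is k'.+1 then
    (forall x, U x -> differentiable f x) /\ forall v, Ck k' U ('D_v f)
  else forall x, U x -> {for x, continuous f}.

Definition Csmooth (R : realType) (V W : normedModType R) (U : set V)
    (f : V -> W) : Prop := forall k, Ck k U f.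

Section CkTheory.
Context {R : realType} {V : normedModType R}.
Implicit Types (U : set V) (k : nat).

Lemma eq_Ck (W : normedModType R) k U (f g : V -> W) :
  open U -> (forall x, U x -> f x = g x) -> Ck k U f -> Ck k U g.
Proof.
move=> oU; elim: k f g => [|k IH] f g fg /=.
  move=> cf x Ux; have nfg : \forall y \near x, f y = g y.
    by apply: filterS (open_nbhs_nbhs (conj oU Ux)) => y; exact: fg.
  have := cf x Ux; rewrite /prop_for /continuous_at (fg x Ux) => cfx; apply: cvg_trans cfx.
  exact: near_eq_cvg.
have nfg x : U x -> \forall y \near x, f y = g y.
  by move=> Ux; apply: filterS (open_nbhs_nbhs (conj oU Ux)) => y; exact: fg.
move=> [df Df]; split.
  move=> x Ux; have [L cL eL] : exists2 L : {linear V -> W}, continuous L &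
      f \o shift x = cst (f x) + L +o_ (0 : V) id.
    by exists ('d f x); [exact: diff_continuous (df x Ux)
                       | exact: diff_locally (df x Ux)].
  suff eLg : g \o shift x = cst (g x) + L +o_ (0 : V) id.
    by apply/diff_locallyP; rewrite (diff_unique cL eLg).
  apply/eqaddoP => e e0; move/eqaddoP: eL => /(_ e e0) H.
  have n0 : \forall y \near (0 : V), f (y + x) = g (y + x).
    have := nfg x Ux; rewrite (near_shift 0 x) /= => H0.
    by apply: filterS H0 => y /=; rewrite subr0.
  near=> y.
  have /= : `|((f \o shift x) - (cst (f x) + L)) y| <= e * `|id y| by near: y.
  rewrite !fctE /= (fg x Ux).
  have -> // : f (y + x) = g (y + x) by near: y.
move=> v; apply: (IH ('D_v f)) => // x Ux.
exact: near_eq_derive (nfg x Ux).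
Unshelve. all: by end_near. Qed.

Lemma CkD k U (f g : V -> R) : open U -> Ck k U f -> Ck k U g -> Ck k U (f + g).
Proof.
move=> oU; elim: k f g => [|k IH] f g /=.
  by move=> cf cg x Ux; apply: continuousD; [exact: cf | exact: cg].
move=> [df Df] [dg Dg]; split=> [x Ux|v].
  by apply: differentiableD; [exact: df | exact: dg].
apply: (@eq_Ck _ k U ('D_v f + 'D_v g)) => //; last exact: IH.
move=> x Ux; rewrite deriveD //; apply: diff_derivable; [exact: df|exact: dg].
Qed.

Lemma CkS k U (f : V -> R) : Ck k.+1 U f -> Ck k U f.
Proof.
elim: k f => [|k IH] f [df Df].
  by move=> x Ux; exact/differentiable_continuous/df.
by split=> // v; exact/IH/Df.
Qed.

Lemma CkM k U (f g : V -> R) : open U -> Ck k U f -> Ck k U g -> Ck k U (f * g).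
Proof.
move=> oU; elim: k f g => [|k IH] f g.
  by move=> cf cg x Ux; apply: continuousM; [exact: cf | exact: cg].
move=> Cf Cg; have [[df Df] [dg Dg]] := (Cf, Cg); split=> [x Ux|v].
  by apply: differentiableM; [exact: df | exact: dg].
apply: (@eq_Ck _ k U (f * 'D_v g + g * 'D_v f)) => //; last first.
  apply: CkD => //; apply: IH; [exact: (CkS Cf)|exact: Dg|exact: (CkS Cg)|exact: Df].
by move=> x Ux; rewrite deriveM //; apply: diff_derivable; [exact: df|exact: dg].
Qed.

Lemma Ck_cst k U (a : R) : Ck k U (cst a).
Proof.
elim: k a => [|k IH] a /=; first by move=> x _; exact: cst_continuous.
split=> [x _|v]; first exact: differentiable_cst.
suff -> : 'D_v (cst a) = cst 0 :> (V -> R) by exact: IH.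
by apply/funext => x; rewrite derive_cst.
Qed.

End CkTheory.

(** * Smooth manifolds *)

Record chart (R : realType) (M : topologicalType) (m : nat) := Chart {
  dom : set M;
  coord : M -> 'rV[R]_m;
  icoord : 'rV[R]_m -> M;
  dom_open : open dom;
  cod_open : open (coord @` dom);
  coordK : forall p, dom p -> icoord (coord p) = p;
  coord_cont : forall p, dom p -> {for p, continuous coord};
  icoord_cont : forall x, (coord @` dom) x -> {for x, continuous icoord} }.

Definition cod (R : realType) (M : topologicalType) m (c : chart R M m) :
  set 'rV[R]_m := coord c @` dom c.

Definition transition (R : realType) (M : topologicalType) m
  (c d : chart R M m) : 'rV[R]_m -> 'rV[R]_m := coord d \o icoord c.

Definition compatible (R : realType) (M : topologicalType) m
    (c d : chart R M m) : Prop :=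
  Csmooth (coord c @` (dom c `&` dom d)) (transition c d) /\
  Csmooth (coord d @` (dom c `&` dom d)) (transition d c).

Record manifold (R : realType) (m : nat) := Manifold {
  carrier :> topologicalType;
  atlas : set (chart R carrier m);
  mfd_hausdorff : hausdorff_space carrier;
  mfd_second_countable : @second_countable carrier;
  atlas_cover : forall p, exists2 c, atlas c & dom c p;
  atlas_compatible : forall c d, atlas c -> atlas d -> compatible c d }.

(* The oriented atlas [A] need not be a part of the given atlas, it only has
   to be compatible with it. *)
Definition orientable (R : realType) m (M : manifold R m) : Prop :=
  exists A : set (chart R M m),
    [/\ forall p, exists2 c, A c & dom c p,
        forall c d, A c -> atlas d -> compatible c d &
        forall c d x, A c -> A d -> (coord c @` (dom c `&` dom d)) x ->
          0 < \det (jacobian (transition c d) x)].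

Definition smooth_on (R : realType) m (M : manifold R m) (U : set M)
    (f : M -> R) : Prop :=
  forall c, atlas c -> Csmooth (icoord c @^-1` U `&` cod c) (f \o icoord c).

Record smooth_map (R : realType) m n (M : manifold R m) (N : manifold R n) :=
  SmoothMap {
    smap :> M -> N;
    smap_cont : continuous smap;
    smap_smooth : forall (V : set N) (f : N -> R), open V ->
      smooth_on V f -> smooth_on (smap @^-1` V) (f \o smap) }.

Definition id_map (R : realType) m (M : manifold R m) : smooth_map M M :=
  @SmoothMap R m m M M id (fun p => cvg_id) (fun V f _ sf => sf).

(** * The ring of smooth functions *)

Record smooth_fun (R : realType) m (M : manifold R m) := SmoothFun {
  sfun :> M -> R;
  sfunP : `[< smooth_on setT sfun >] }.

Section SmoothFunRing.
Context {R : realType} {m : nat} {M : manifold R m}.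

Definition smooth_pred : {pred M -> R} :=
  fun f => `[< smooth_on setT f >].

HB.instance Definition _ := [isSub of smooth_fun M for @sfun R m M].
HB.instance Definition _ := gen_eqMixin (smooth_fun M).
HB.instance Definition _ := gen_choiceMixin (smooth_fun M).

Lemma open_chart_cod (c : chart R M m) : open (icoord c @^-1` setT `&` cod c).
Proof. by rewrite preimage_setT setTI; exact: cod_open. Qed.

Lemma smooth_pred_subring : subring_closed smooth_pred.
Proof.
have H1 : (1 : M -> R) \in smooth_pred.
  by apply/asboolP => c ac k; exact: (Ck_cst k _ 1).
have HM : {in smooth_pred &, forall f g, f * g \in smooth_pred}.
  move=> f g /asboolP sf /asboolP sg; apply/asboolP => c ac k.
  exact: (CkM (f := f \o icoord c) (g := g \o icoord c) (@open_chart_cod c)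
    (sf c ac k) (sg c ac k)).
have HD : {in smooth_pred &, forall f g, f + g \in smooth_pred}.
  move=> f g /asboolP sf /asboolP sg; apply/asboolP => c ac k.
  exact: (CkD (f := f \o icoord c) (g := g \o icoord c) (@open_chart_cod c)
    (sf c ac k) (sg c ac k)).
have HN1 : (- 1 : M -> R) \in smooth_pred.
  by apply/asboolP => c ac k; exact: (Ck_cst k _ (- 1)).
by split=> // f g sf sg; apply: HD => //; rewrite -mulN1r; exact: HM.
Qed.

HB.instance Definition _ :=
  GRing.isSubringClosed.Build (M -> R) smooth_pred smooth_pred_subring.
HB.instance Definition _ :=
  GRing.SubChoice_isSubComPzRing.Build (M -> R) smooth_pred (smooth_fun M)
    smooth_pred_subring.


Definition sfun_cst (a : R) : smooth_fun M :=
  SmoothFun (asboolT (fun c _ k => Ck_cst k _ a)).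

Lemma sfun_eq (f h : smooth_fun M) : (forall p, f p = h p) -> f = h.
Proof. by move=> fh; apply/val_inj/funext => p; exact: fh. Qed.

End SmoothFunRing.

Definition pull (R : realType) m n (M : manifold R m) (N : manifold R n)
    (u : smooth_map M N) (f : smooth_fun N) : smooth_fun M :=
  SmoothFun (asboolT (smap_smooth u openT (asboolW (sfunP f)))).

Lemma pull_id (R : realType) m (M : manifold R m) (f : smooth_fun M) :
  pull (id_map M) f = f.
Proof. exact: sfun_eq. Qed.

(** * Vector fields *)

Obligation Tactic := idtac.

(* A section of u^{-1}TN is a derivation from C^oo(N) to C^oo(M) along the
   pullback of functions; vector fields are the case where u is the identity. *)
Record section (R : realType) m n (M : manifold R m) (N : manifold R n)
    (u : smooth_map M N) := Section_ {
  sec :> smooth_fun N -> smooth_fun M;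
  sec_linear : forall a f h,
    sec (sfun_cst a * f + h) = sfun_cst a * sec f + sec h;
  sec_leibniz : forall f h, sec (f * h) = pull u f * sec h + sec f * pull u h }.

Notation vfield M := (section (id_map M)).

Section SectionModule.
Context {R : realType} {m n : nat} {M : manifold R m} {N : manifold R n}.
Context {u : smooth_map M N}.
Implicit Types X Y Z : section u.

HB.instance Definition _ := gen_eqMixin (section u).
HB.instance Definition _ := gen_choiceMixin (section u).

Lemma sec_eq X Y : (forall f, X f = Y f) -> X = Y.
Proof.
case: X => X Xl XL; case: Y => Y Yl YL /= /funext XY; move: Xl XL Yl YL.
by rewrite XY => ? ? ? ?; congr Section_; exact: Prop_irrelevance.
Qed.

Lemma secD X f h : X (f + h) = X f + X h.
Proof.
have c1 : sfun_cst 1 = 1 :> smooth_fun N by exact: sfun_eq.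
have c1' : sfun_cst 1 = 1 :> smooth_fun M by exact: sfun_eq.
by have := sec_linear X 1 f h; rewrite c1 c1' !mul1r.
Qed.

Program Definition sec_zero : section u := @Section_ _ _ _ _ _ _ (fun=> 0) _ _.
Next Obligation. by move=> a f h /=; rewrite mulr0 addr0. Qed.
Next Obligation. by move=> f h /=; rewrite mulr0 mul0r addr0. Qed.

Program Definition sec_add X Y : section u :=
  @Section_ _ _ _ _ _ _ (fun f => X f + Y f) _ _.
Next Obligation. by move=> X Y a f h /=; rewrite !sec_linear mulrDr addrACA. Qed.
Next Obligation.
by move=> X Y f h /=; rewrite !sec_leibniz mulrDr mulrDl addrACA.
Qed.

Program Definition sec_opp X : section u :=
  @Section_ _ _ _ _ _ _ (fun f => - X f) _ _.
Next Obligation. by move=> X a f h /=; rewrite sec_linear opprD mulrN. Qed.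
Next Obligation. by move=> X f h /=; rewrite sec_leibniz opprD mulrN mulNr. Qed.

Program Definition sec_scale (c : smooth_fun M) X : section u :=
  @Section_ _ _ _ _ _ _ (fun f => c * X f) _ _.
Next Obligation. by move=> c X a f h /=; rewrite sec_linear mulrDr mulrCA. Qed.
Next Obligation.
by move=> c X f h /=; rewrite sec_leibniz mulrDr mulrCA; congr (_ + _); rewrite mulrA.
Qed.

Lemma sec_addA : associative sec_add.
Proof. by move=> X Y Z; apply: sec_eq => f; exact: addrA. Qed.
Lemma sec_addC : commutative sec_add.
Proof. by move=> X Y; apply: sec_eq => f; exact: addrC. Qed.
Lemma sec_add0 : left_id sec_zero sec_add.
Proof. by move=> X; apply: sec_eq => f; exact: add0r. Qed.
Lemma sec_addN : left_inverse sec_zero sec_opp sec_add.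
Proof. by move=> X; apply: sec_eq => f; exact: addNr. Qed.

HB.instance Definition _ :=
  GRing.isZmodule.Build (section u) sec_addA sec_addC sec_add0 sec_addN.

Lemma sec_scaleA a b X : sec_scale a (sec_scale b X) = sec_scale (a * b) X.
Proof. by apply: sec_eq => f; exact: mulrA. Qed.
Lemma sec_scale1 : left_id 1 sec_scale.
Proof. by move=> X; apply: sec_eq => f; exact: mul1r. Qed.
Lemma sec_scaleDr : right_distributive sec_scale +%R.
Proof. by move=> a X Y; apply: sec_eq => f; exact: mulrDr. Qed.
Lemma sec_scaleDl X : {morph sec_scale^~ X : a b / a + b}.
Proof. by move=> a b; apply: sec_eq => f; exact: mulrDl. Qed.

HB.instance Definition _ := GRing.Zmodule_isLmodule.Build (smooth_fun M)
  (section u) sec_scaleA sec_scale1 sec_scaleDr sec_scaleDl.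

(* The differential of u: (u_* X) f = X (f o u). *)
Program Definition push (X : vfield M) : section u :=
  @Section_ _ _ _ _ _ _ (fun f => X (pull u f)) _ _.
Next Obligation.
move=> X a f h /=; rewrite -sec_linear; congr (X _); exact: sfun_eq.
Qed.
Next Obligation.
move=> X f h /=.
have -> : pull u (f * h) = pull u f * pull u h by exact: sfun_eq.
by rewrite sec_leibniz !pull_id.
Qed.

(* The section Y o u. *)
Program Definition restr (Y : vfield N) : section u :=
  @Section_ _ _ _ _ _ _ (fun f => pull u (Y f)) _ _.
Next Obligation. by move=> Y a f h /=; rewrite sec_linear; exact: sfun_eq. Qed.
Next Obligation.
by move=> Y f h /=; rewrite sec_leibniz !pull_id; exact: sfun_eq.
Qed.

(* Equality of the values of two sections in T_{u(p)} N. *)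
Definition eq_at (p : M) X Y : Prop := forall f, X f p = Y f p.

End SectionModule.

Program Definition bracket (R : realType) m (M : manifold R m)
    (X Y : vfield M) : vfield M :=
  @Section_ _ _ _ _ _ _ (fun f => X (Y f) - Y (X f)) _ _.
Next Obligation.
by move=> R m M X Y a f h /=; rewrite !sec_linear mulrBr opprD addrACA.
Qed.
Next Obligation.
move=> R m M X Y f h /=; rewrite !sec_leibniz !secD !sec_leibniz !pull_id.
rewrite mulrBr mulrBl -!addrA; congr (_ + _); rewrite !opprD !addrA.
rewrite [X f * Y h + Y f * X h]addrC.
have aux (V : zmodType) (a b c d : V) : a + b + c - d - a - b = - d + c.
  by rewrite -[_ - a - b]addrA -opprD -[_ - d]addrA addrAC subrr add0r addrC.
by rewrite aux.
Qed.

(** * Metrics and connections *)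

Record metric (R : realType) m (M : manifold R m) := Metric {
  met :> vfield M -> vfield M -> smooth_fun M;
  met_sym : forall X Y, met X Y = met Y X;
  met_linear : forall f X Y Z, met (f *: X + Y) Z = f * met X Z + met Y Z;
  met_ge0 : forall X p, 0 <= met X X p;
  met_eq0 : forall X p, met X X p = 0 <-> eq_at p X 0 }.

Section Connections.
Context {R : realType} {m n : nat} {M : manifold R m} {N : manifold R n}.

Definition connection (u : smooth_map M N) : Type :=
  vfield M -> section u -> section u.

Definition is_connection (u : smooth_map M N) (D : connection u) : Prop :=
  [/\ forall f X Y s, D (f *: X + Y) s = f *: D X s + D Y s,
      forall X s t, D X (s + t) = D X s + D X t &
      forall X f s, D X (f *: s) = X f *: s + f *: D X s].

End Connections.

Notation affine_connection M := (connection (id_map M)).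

Section Geometry.
Context {R : realType} {m : nat} {M : manifold R m}.
Implicit Types (g : metric M) (D : affine_connection M) (X Y Z W : vfield M).

Definition torsion_free D : Prop :=
  forall X Y, D X Y - D Y X = bracket X Y.

(* (D_X g)(Y, Z) *)
Definition cov_metric D g X Y Z : smooth_fun M :=
  X (g Y Z) - g (D X Y) Z - g Y (D X Z).

Definition is_statistical g D : Prop :=
  [/\ is_connection D, torsion_free D &
      forall X Y Z, cov_metric D g X Y Z = cov_metric D g Y X Z].

Definition is_levi_civita g D : Prop :=
  [/\ is_connection D, torsion_free D &
      forall X Y Z, cov_metric D g X Y Z = 0].

Definition is_conjugate g D D' : Prop :=
  is_connection D' /\
  forall X Y Z, X (g Y Z) = g (D X Y) Z + g Y (D' X Z).

(* The objects below that are determined by a characteristic property are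
   obtained by choice, with 0 as a junk value when there is no such object. *)
Definition levi_civita g : affine_connection M := xget 0 (is_levi_civita g).

Definition conjugate g D : affine_connection M := xget 0 (is_conjugate g D).

Definition curvature D X Y Z : vfield M :=
  D X (D Y Z) - D Y (D X Z) - D (bracket X Y) Z.

Definition L_tensor g D : vfield M -> vfield M -> vfield M -> vfield M :=
  xget 0 [set L | forall X Y Z W, g (L Z W X) Y = g (curvature D X Y Z) W].

(* Here and below [D0] stands for the Levi-Civita connection of [g]. *)
Definition K_tensor D0 D X Y : vfield M := D X Y - D0 X Y.

(* Any smooth orthonormal frame given near a point coincides, in a possibly
   smaller neighbourhood, with the restriction of global vector fields, so
   that local frames may be taken of this form; every point has one. *)
Definition orthonormal_frame g (U : set M) (E : 'I_m -> vfield M) : Prop :=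
  [/\ open U,
      forall i j p, U p -> g (E i) (E j) p = (i == j)%:R &
      forall X p, U p -> exists a : 'I_m -> R,
        eq_at p X (\sum_i sfun_cst (a i) *: E i)].

(* S = \sum_i B (E i) for all local orthonormal frames E. *)
Definition is_trace g n (N : manifold R n) (u : smooth_map M N)
    (B : vfield M -> section u) (S : section u) : Prop :=
  forall U E, orthonormal_frame g U E ->
    forall p, U p -> eq_at p S (\sum_i B (E i)).

(* The section given on the domain of each orthonormal frame E by the formula
   [S E] vanishes on M. *)
Definition vanishes g n (N : manifold R n) (u : smooth_map M N)
    (S : ('I_m -> vfield M) -> section u) : Prop :=
  forall U E, orthonormal_frame g U E -> forall p, U p -> eq_at p (S E) 0.

Definition is_tchebychev g D0 D T : Prop :=
  is_trace g (fun X => K_tensor D0 D X X) T.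

Definition tchebychev g D0 D : vfield M := xget 0 (is_tchebychev g D0 D).

Section Frame.
Variable E : 'I_m -> vfield M.

Definition divergence g D0 X : smooth_fun M := \sum_i g (D0 (E i) X) (E i).

Definition ricci g D0 X Y : smooth_fun M :=
  \sum_i g (curvature D0 (E i) X Y) (E i).

Definition laplacian n (N : manifold R n) (u : smooth_map M N)
    (Du : connection u) D (s : section u) : section u :=
  \sum_i (Du (E i) (Du (E i) s) - Du (D (E i) (E i)) s).

End Frame.
End Geometry.

(** * Maps *)

Section Maps.
Context {R : realType} {m n : nat} {M : manifold R m} {N : manifold R n}.
Variable u : smooth_map M N.

Definition is_linear (V W : lmodType (smooth_fun M)) (F : V -> W) : Prop :=
  forall f x y, F (f *: x + y) = f *: F x + F y.

(* Extension to sections of u^{-1}TN, by linearity over C^oo(M), of tensors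
   on N; these sections are generated by those of the form Y o u. *)
Definition pull2 (B : vfield N -> vfield N -> vfield N) :
    section u -> section u -> section u :=
  xget 0 [set B' | [/\ forall t, is_linear (B'^~ t), forall s, is_linear (B' s) &
    forall Y Z, B' (restr Y) (restr Z) = restr (B Y Z)]].

Definition pull3 (B : vfield N -> vfield N -> vfield N -> vfield N) :
    section u -> section u -> section u -> section u :=
  xget 0 [set B' | [/\ forall t r, is_linear (fun s => B' s t r),
    forall s r, is_linear (fun t => B' s t r),
    forall s t, is_linear (B' s t) &
    forall X Y Z, B' (restr X) (restr Y) (restr Z) = restr (B X Y Z)]].

(* [ext s Y] is D_s Y for a section s of u^{-1}TN, and the induced connection
   satisfies D^u_X (Y o u) = D_{u_* X} Y. *)
Definition is_induced (D : affine_connection N) (Du : connection u) : Prop :=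
  is_connection Du /\
  exists ext : section u -> vfield N -> section u,
    [/\ forall Y, is_linear (ext^~ Y),
        forall Z Y, ext (restr Z) Y = restr (D Z Y) &
        forall X Y, Du X (restr Y) = ext (push X) Y].

Definition induced (D : affine_connection N) : connection u :=
  xget 0 (is_induced D).

Definition tension (g : metric M) (DM : affine_connection M)
    (DN : affine_connection N) : section u :=
  xget 0 (is_trace g (fun X => induced DN X (push X) - push (DM X X))).

(* The formula for the statistical bi-tension field in a local orthonormal
   frame E. *)
Definition bitension (g : metric M) (DM : affine_connection M)
    (h : metric N) (DN : affine_connection N) (E : 'I_m -> vfield M) :
    section u :=
  let D0M := levi_civita g in
  let D0N := levi_civita h in
  let tau := tension g DM DN in
  laplacian E (induced (conjugate h DN)) (conjugate g DM) tau
  + divergence E g D0M (tchebychev g D0M DM) *: tau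
  - \sum_i pull3 (L_tensor h DN) (push (E i)) tau (push (E i))
  - pull2 (K_tensor D0N DN) tau tau.

End Maps.

(* Main.v *)
Require Import Defs.
From HB Require Import structures.
From mathcomp Require Import all_boot all_order all_algebra.
From mathcomp Require Import all_classical all_reals all_analysis.
From mathcomp Require Import ring lra.

Import Defs.

Set Implicit Arguments.
Unset Strict Implicit.
Unset Printing Implicit Defensive.

Import Order.TTheory GRing.Theory Num.Theory.
Import numFieldNormedType.Exports.

Local Open Scope classical_set_scope.
Local Open Scope ring_scope.

(** Write [D0] for the Levi-Civita connection, [K = D - D0], [A] for the left
    hand side of the first equation (rough Laplacian of [T] plus Ricci term) and
    [B] for that of the second one.  The theorem rests on the two identities
      tau_2(id) = - A - B   and   bar tau_2(id) = A - B,
    so that both bi-tension fields vanish exactly when [A] and [B] do.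

    For the first identity ([bitension_id]), the target carries [D0], which is
    its own conjugate and has no difference tensor, while [tau(id) = - T].  As
    the conjugate of [D] is [D0 - K], the Laplacian of the pulled-back bundle
    is the rough Laplacian plus the derivative along [tr K = T]
    ([laplacian_connection]).  By the pair symmetry of the Riemann tensor the
    tensor [L] of [D0] is its curvature, and the trace of [R(e_i, T) e_i] is
    the opposite of the Ricci term ([curvature_trace_ricci]).  The second
    identity is the first one for the conjugate connection, whose difference
    tensor is [- K] ([K_tensor_conjugate]) and Tchebychev field [- T].

    The connections and tensors that are given by a choice among the objects
    with a characteristic property are identified with the expected ones by
    uniqueness of these objects.  A trace, such as the tension field, is only
    controlled on the domains of orthonormal frames: two traces of the same
    form agree there, and one has to know that derivatives see only the values
    on an open set.  This is the role of bump functions ([exists_bump]), built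
    from [exp (- 1 / s)] in a chart and extended by 0; the extension is smooth
    because compact sets of a Hausdorff space are closed. *)

(** * Flat functions of one variable *)

Section Flat.
Context {R : realType}.
Implicit Types (n k : nat) (s : R).

(** [s ^ - n * exp (- 1 / s)] for positive [s], extended by 0; [n = 0] is the
    usual flat function.  The whole family is needed because the derivative of
    a member is a combination of two others. *)
Definition flat n s : R :=
  if 0 < s then s^-1 ^+ n * expR (- s^-1) else 0.

Lemma flat_gt0 n s : 0 < s -> 0 < flat n s.
Proof. by move=> s0; rewrite /flat s0 mulr_gt0 ?expR_gt0// exprn_gt0 ?invr_gt0. Qed.

Lemma flat_le0 n s : s <= 0 -> flat n s = 0.
Proof. by rewrite /flat ltNge => ->. Qed.

(** [flat n.+1] is the difference quotient of [flat n] at 0. *)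
Lemma flatS n s : flat n s = flat n.+1 s * s.
Proof.
rewrite /flat; case: ifPn => [s0|_]; last by rewrite mul0r.
by rewrite exprS; field; rewrite gt_eqF.
Qed.

Lemma flat_bound n s : `|flat n s| <= n.+1`!%:R * `|s|.
Proof.
have [s0|s0] := ltP 0 s; last by rewrite flat_le0// normr0 mulr_ge0.
rewrite gtr0_norm ?flat_gt0// gtr0_norm//.
have i0 : 0 < s^-1 by rewrite invr_gt0.
have f0 : 0 < n.+1`!%:R :> R by rewrite ltr0n fact_gt0.
have -> : flat n s = s^-1 ^+ n / expR s^-1 by rewrite /flat s0 expRN.
have -> : s^-1 ^+ n = (s^-1 ^+ n.+1 / n.+1`!%:R) * (n.+1`!%:R * s).
  by rewrite exprS; field; rewrite !gt_eqF.
rewrite ler_pdivrMr ?expR_gt0// mulrC ler_wpM2l//.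
  by rewrite mulr_ge0// ltW.
by apply: le_trans (expR_ge1Dxn n (ltW i0)); rewrite lerDr.
Qed.

Lemma flat_cvg0 n : {for 0, continuous (flat n)}.
Proof.
rewrite /prop_for /continuous_at [flat n 0]flat_le0//.
apply/cvgr0Pnorm_le => e e0.
near=> s; apply: le_trans (flat_bound n s) _.
rewrite mulrC -ler_pdivlMr ?ltr0n ?fact_gt0//.
near: s; apply: (cvgr0_norm_le (id : R -> R)); first exact: cvg_id.
by rewrite divr_gt0// ltr0n fact_gt0.
Unshelve. all: by end_near. Qed.

Lemma is_derive_flat n s :
  is_derive s 1 (flat n) (flat n.+2 s - n%:R * flat n.+1 s).
Proof.
have [s0|s0|->] := ltgtP s 0; last 1 first.
- rewrite !flat_le0// mulr0 subrr; apply/is_derive1_caratheodory.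
  exists (flat n.+1); split; [|exact: flat_cvg0|exact: flat_le0].
  by move=> z; rewrite (flat_le0 n (lexx 0)) !subr0 -flatS.
- rewrite !flat_le0 ?ltW// mulr0 subrr.
  suff d0 : is_derive s (1 : R) (cst 0 : R -> R) 0.
    apply: (near_eq_is_derive _ d0); near=> t.
    by rewrite flat_le0// ltW//; near: t; exact: lt_nbhsl.
  exact: (@is_derive_cst R R R 0 s 1).
apply: (near_eq_is_derive (f := fun s => s^-1 ^+ n * expR (- s^-1))).
  by near=> t; rewrite /flat ifT//; near: t; exact: lt_nbhsr.
have sn0 : s != 0 by rewrite gt_eqF.
have dV : is_derive s 1 (fun t : R => t^-1) (- s ^- 2).
  by rewrite -[- _]mulr1; apply: is_deriveV.
have dE : is_derive s 1 (fun t : R => expR (- t^-1)) (s ^- 2 * expR (- s^-1)).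
  apply: (is_derive_eq (is_derive1_comp _ (is_deriveN dV))).
  by rewrite opprK mulrC.
(* written as a product in the ring of functions, for the product rule *)
have -> : (fun t => t^-1 ^+ n * expR (- t^-1)) =
    (fun t => t^-1) ^+ n * (fun t => expR (- t^-1)) :> (R -> R).
  by apply/funext => t; rewrite !fctE.
apply: (is_derive_eq (is_deriveM (is_deriveX n dV) dE)).
rewrite /flat s0 /GRing.scale !fctE /=; set e := expR _.
case: n => [|n] /=; rewrite ?mulr0n ?mulrS.
  by field.
by rewrite !exprS; field.
Unshelve. all: by end_near. Qed.

End Flat.

(** * Smoothness of compositions *)

Section SmoothCalculus.
Context {R : realType} {V : normedModType R}.
Implicit Types (U : set V) (k n : nat).

(** [Ck] only looks at the points of [U], with derivatives taken in the whole
    space, so that [A] below need not even be open. *)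
Lemma Ck_local (W : normedModType R) k U (f : V -> W) :
  (forall x, U x -> exists2 A : set V, A x & Ck k A f) -> Ck k U f.
Proof.
elim: k f => [|k IH] f H /=; first by move=> x /H[A Ax]; exact.
split=> [x /H[A Ax [df _]]|v]; first exact: df.
by apply: IH => x /H[A Ax [_ Df]]; exists A => //; exact: Df.
Qed.

Lemma Ck_prod k U (I : Type) (r : seq I) (f : I -> V -> R) :
  open U -> (forall i, Ck k U (f i)) -> Ck k U (\prod_(i <- r) f i).
Proof.
move=> oU Cf; elim: r => [|i r IH]; first by rewrite big_nil; exact: (Ck_cst k U 1).
by rewrite big_cons; exact: CkM.
Qed.

Lemma Ck_coord k U m (F : V -> 'rV[R]_m) j :
  open U -> Ck k U F -> Ck k U (fun x => F x 0 j).
Proof.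
move=> oU; elim: k F => [|k IH] F /=.
  move=> cF x Ux; have := cF x Ux.
  rewrite /prop_for => cFx.
  by apply: (@continuous_comp _ _ _ F (fun v : 'rV[R]_m => v 0 j)) => //;
    exact: coord_continuous.
move=> [dF DF]; split=> [x Ux|v].
  apply: (@differentiable_comp _ _ _ _ F (fun v : 'rV[R]_m => v 0 j)).
    exact: dF.
  exact: differentiable_coord.
apply: (eq_Ck (f := fun x => 'D_v F x 0 j)) => //; last exact: IH.
by move=> x Ux; rewrite derive_mx ?mxE//; apply: diff_derivable; exact: dF.
Qed.

Lemma Ck_flat k n U (f : V -> R) :
  open U -> Ck k U f -> Ck k U (flat n \o f).
Proof.
move=> oU.
have dflat i s : differentiable (flat i : R -> R) s.
  by apply/derivable1_diffP; have [] := is_derive_flat i s.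
elim: k n f => [|k IH] n f.
  move=> cf x Ux; apply: continuous_comp; first exact: cf.
  exact: differentiable_continuous.
move=> Cf; have [df Df] := Cf; split=> [x Ux|v].
  by apply: differentiable_comp; [exact: df|exact: dflat].
apply: (eq_Ck (f := (flat n.+2 \o f + cst (- n%:R) * (flat n.+1 \o f)) * 'D_v f)) => //.
  move=> x Ux; rewrite deriveE; last first.
    by apply: differentiable_comp; [exact: df|exact: dflat].
  rewrite diff_comp//; last exact: df.
  rewrite /= diff1E// -deriveE; last exact: df.
  rewrite derive1E; have [_ ->] := is_derive_flat n (f x).
  by rewrite !fctE /= mulNr mulrC.
apply: CkM => //; last exact: Df.
apply: CkD => //; first exact/IH/CkS.
by apply: CkM => //; [exact: Ck_cst|exact/IH/CkS].
Qed.

End SmoothCalculus.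

(** * Bump functions on a manifold *)

Section Bump.
Context {R : realType} {m : nat}.

(** A smooth function on ['rV_m], positive at [a] and supported in the closed
    ball of centre [a] and radius [e], which is a cube since the norm is the sup
    norm. *)
Definition box_bump (a : 'rV[R]_m) (e : R) (x : 'rV[R]_m) : R :=
  \prod_(j < m) (flat 0 (e + (x 0 j - a 0 j)) * flat 0 (e - (x 0 j - a 0 j))).

Lemma box_bump_gt0 a e : 0 < e -> 0 < box_bump a e a.
Proof.
by move=> e0; apply: prodr_gt0 => j _; rewrite subrr subr0 addr0 mulr_gt0 ?flat_gt0.
Qed.

Lemma box_bump_support a e x : 0 < e -> box_bump a e x != 0 -> `|a - x| <= e.
Proof.
move=> e0 /prodf_neq0 H; rewrite [leLHS]/Num.Def.normr /= mx_normrE.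
apply/bigmax_leP; split=> [|[i j] _ /=]; first exact: ltW.
rewrite !mxE ord1 distrC ler_norml; apply/andP; split.
  rewrite leNgt; apply/negP => h; have /eqP := H j isT; apply.
  by rewrite flat_le0 ?mul0r//; lra.
rewrite leNgt; apply/negP => h; have /eqP := H j isT; apply.
by rewrite [X in _ * X]flat_le0 ?mulr0//; lra.
Qed.

Lemma Ck_box_bump (V : normedModType R) k (U : set V) (F : V -> 'rV[R]_m) a e :
  open U -> Ck k U F -> Ck k U (box_bump a e \o F).
Proof.
move=> oU CF.
pose f j x := F x 0 j - a 0 j.
have Cf j : Ck k U (f j).
  apply: (CkD (f := fun x => F x 0 j) (g := cst (- a 0 j))) => //.
    exact: Ck_coord.
  exact: Ck_cst.
have -> : box_bump a e \o F = \prod_(j < m)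
    ((flat 0 \o (cst e + f j)) * (flat 0 \o (cst e + cst (-1) * f j))).
  apply/funext => x; rewrite fct_prodE /box_bump /=; apply: eq_bigr => j _.
  by rewrite !fctE /= mulN1r.
apply: Ck_prod => // j; apply: CkM => //; apply: Ck_flat => //; apply: CkD => //.
- exact: Ck_cst.
- exact: Ck_cst.
- by apply: CkM => //; exact: Ck_cst.
Qed.

Lemma open_chart_image (M : topologicalType) (c : chart R M m) (A : set M) :
  open A -> open (coord c @` (A `&` dom c)).
Proof.
move=> oA; rewrite openE => x [q [Aq dq] <-] /=.
have cq : cod c (coord c q) by exists q.
have := @icoord_cont _ _ _ c _ cq; rewrite /prop_for /continuous_at coordK// => ic.
have := ic A (open_nbhs_nbhs (conj oA Aq)) .
rewrite nbhs_simpl /= => icA.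
have codN := open_nbhs_nbhs (conj (@cod_open _ _ _ c) cq).
apply: filterS (filterI icA codN) => y [/= Ay] [q' dq' yE]; exists q' => //; split => //.
by move: Ay; rewrite -yE coordK.
Qed.

(** The function is supported in the compact, hence closed, set [K], the image
    of a small ball in a chart at [p]. *)
Theorem exists_bump (M : manifold R m) (U : set M) (p : M) : open U -> U p ->
  exists phi : smooth_fun M, phi p = 1 /\ forall q, ~ U q -> phi q = 0.
Proof.
move=> oU Up; have [c ac cp] := atlas_cover p.
pose a := coord c p.
have : nbhs a (coord c @` (U `&` dom c)).
  by apply: open_nbhs_nbhs; split; [exact: open_chart_image|exists p].
move=> /nbhs_ballP[r /= r0 rU].
pose e := r / 2; have e0 : 0 < e by rewrite divr_gt0.
pose B := [set x : 'rV[R]_m | `|a - x| <= e].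
have BU : B `<=` coord c @` (U `&` dom c).
  move=> x Bx; apply: rU; rewrite -ball_normE /=; apply: le_lt_trans Bx _.
  by rewrite /e ltr_pdivrMr// ltr_pMr// ltr1n.
have cB : compact B.
  apply: bounded_closed_compact.
    exists (`|a| + e); split=> [|N]; first exact: num_real.
    move=> /ltW eN x Bx /=; apply: le_trans eN.
    rewrite -[x](subKr a) (le_trans (ler_normB _ _))// lerD2l.
    exact: Bx.
  exact: (@closed_closed_ball_ R 'rV[R]_m a e).
pose K := icoord c @` B.
have KU q : K q -> U q /\ dom c q.
  by move=> [x /BU[q' [Uq' dq'] <-] <-]; rewrite coordK.
have clK : closed K.
  apply: compact_closed; first exact: mfd_hausdorff.
  apply: continuous_compact => //; apply: continuous_in_subspaceT => x /set_mem Bx.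
  by apply: icoord_cont; have [q [_ dq] <-] := BU _ Bx; exists q.
pose phi q : R := if `[< dom c q >] then box_bump a e (coord c q) / box_bump a e a else 0.
have phiK q : ~ K q -> phi q = 0.
  move=> nKq; rewrite /phi; case: asboolP => // dq.
  have [->|/box_bump_support-/(_ e0) Bq] := eqVneq (box_bump a e (coord c q)) 0.
    by rewrite mul0r.
  by exfalso; apply: nKq; exists (coord c q) => //; rewrite coordK.
have sphi : smooth_on setT phi.
  move=> d ad k; apply: Ck_local => x [_ [q dq qx]].
  (* off the closed set [K] the function vanishes near the point; on [K] it is
     smooth because the two charts are compatible *)
  have [Kq|nKq] := pselect (K q); last first.
    exists (coord d @` (~` K `&` dom d)); first by exists q.
    apply: (eq_Ck (f := cst 0)); last exact: Ck_cst.
      by apply: open_chart_image; rewrite openC.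
    by move=> y [q' [nKq' dq'] <-] /=; rewrite coordK// phiK.
  have [_ cq] := KU _ Kq.
  exists (coord d @` (dom c `&` dom d)); first by exists q.
  have oV : open (coord d @` (dom c `&` dom d)).
    by apply: open_chart_image; exact: dom_open.
  apply: (eq_Ck (f := (box_bump a e \o transition d c) * cst (box_bump a e a)^-1)) => //.
    move=> y [q' [cq' dq'] <-] /=; rewrite /phi /transition !fctE /= coordK//.
    by rewrite asboolT.
  apply: CkM => //; last exact: Ck_cst.
  by apply: Ck_box_bump => //; have [_] := atlas_compatible ac ad; exact.
exists (SmoothFun (asboolT sphi)); split=> [|q nUq] /=.
  by rewrite /phi asboolT// divff// gt_eqF// box_bump_gt0.
by apply: phiK => /KU[].
Qed.

End Bump.

(** * Smooth functions and vector fields *)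

Section Evaluation.
Context {R : realType} {m : nat} {M : manifold R m}.
Implicit Types (f h : smooth_fun M) (X Y Z : vfield M) (p : M).

Lemma sfun0 p : (0 : smooth_fun M) p = 0. Proof. by []. Qed.
Lemma sfunD f h p : (f + h) p = f p + h p. Proof. by []. Qed.
Lemma sfunN f p : (- f) p = - f p. Proof. by []. Qed.
Lemma sfunM f h p : (f * h) p = f p * h p. Proof. by []. Qed.
Definition sfunE := (sfun0, sfunD, sfunN, sfunM).

Lemma sec0E f : (0 : vfield M) f = 0. Proof. by []. Qed.
Lemma secDE X Y f : (X + Y) f = X f + Y f. Proof. by []. Qed.
Lemma secNE X f : (- X) f = - X f. Proof. by []. Qed.
Lemma secZE h X f : (h *: X) f = h * X f. Proof. by []. Qed.
Definition secE := (sec0E, secDE, secNE, secZE).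

Lemma sfun_sum (I : Type) (r : seq I) (F : I -> smooth_fun M) p :
  (\sum_(i <- r) F i) p = \sum_(i <- r) F i p.
Proof. by elim/big_rec2: _ => // i x y _ <-. Qed.

Lemma sec_sum (I : Type) (r : seq I) (F : I -> vfield M) f :
  (\sum_(i <- r) F i) f = \sum_(i <- r) F i f.
Proof. by elim/big_rec2: _ => // i x y _ <-. Qed.

Lemma secN X f : X (- f) = - X f.
Proof.
have X0 : X 0 = 0 by apply: (addrI (X 0)); rewrite -secD !addr0.
by apply/eqP; rewrite -addr_eq0 -secD addNr X0.
Qed.

Lemma restr_id X : restr (u := id_map M) X = X.
Proof. by apply: sec_eq => f; exact: pull_id. Qed.

Lemma push_id X : push (u := id_map M) X = X.
Proof. by apply: sec_eq => f /=; rewrite pull_id. Qed.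

Lemma jacobi X Y Z :
  bracket X (bracket Y Z) + bracket Y (bracket Z X) + bracket Z (bracket X Y) = 0.
Proof.
apply: sec_eq => f /=; rewrite !secD !secN; apply: sfun_eq => p.
by rewrite !sfunE; ring.
Qed.

Lemma bracketC X Y : bracket X Y = - bracket Y X.
Proof. by apply: sec_eq => f /=; rewrite opprB. Qed.

Lemma bracketZl f X Y : bracket (f *: X) Y = f *: bracket X Y - Y f *: X.
Proof.
apply: sec_eq => h /=; rewrite sec_leibniz !pull_id; apply: sfun_eq => p.
by rewrite !sfunE; ring.
Qed.

Lemma bracketDl X Y Z : bracket (X + Y) Z = bracket X Z + bracket Y Z.
Proof.
apply: sec_eq => h /=; rewrite secD; apply: sfun_eq => p.
by rewrite !sfunE; ring.
Qed.

End Evaluation.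

(** * Metrics and conjugate connections *)

Section Metric.
Context {R : realType} {m : nat} {M : manifold R m}.
Variable g : metric M.
Implicit Types (f : smooth_fun M) (X Y Z W : vfield M) (p : M).

Lemma metDl X Y Z : g (X + Y) Z = g X Z + g Y Z.
Proof. by have := met_linear g 1 X Y Z; rewrite scale1r mul1r. Qed.
Lemma met0l Z : g 0 Z = 0.
Proof. by apply: (addrI (g 0 Z)); rewrite -metDl !addr0. Qed.
Lemma metZl f X Z : g (f *: X) Z = f * g X Z.
Proof. by have := met_linear g f X 0 Z; rewrite !addr0 met0l addr0. Qed.
Lemma metNl X Z : g (- X) Z = - g X Z.
Proof. by rewrite -scaleN1r metZl mulN1r. Qed.
Lemma metBl X Y Z : g (X - Y) Z = g X Z - g Y Z.
Proof. by rewrite metDl metNl. Qed.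
Lemma metDr X Y Z : g Z (X + Y) = g Z X + g Z Y.
Proof. by rewrite !(met_sym g Z) metDl. Qed.
Lemma metBr X Y Z : g Z (X - Y) = g Z X - g Z Y.
Proof. by rewrite !(met_sym g Z) metBl. Qed.
Lemma metZr f X Z : g Z (f *: X) = f * g Z X.
Proof. by rewrite !(met_sym g Z) metZl. Qed.
Lemma met_suml (I : Type) (r : seq I) (F : I -> vfield M) Z :
  g (\sum_(i <- r) F i) Z = \sum_(i <- r) g (F i) Z.
Proof.
by elim/big_rec2: _ => [|i x y _ <-]; [exact: met0l|exact: metDl].
Qed.

Lemma met_inj X Y : (forall Z, g X Z = g Y Z) -> X = Y.
Proof.
move=> XY; have H p : eq_at p (X - Y) 0 by apply/(met_eq0 g); rewrite metBl XY subrr.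
by apply/eqP; rewrite -subr_eq0; apply/eqP/sec_eq => f; apply: sfun_eq => p; exact: H.
Qed.

(** The value of a metric at [p] only depends on the values of its arguments at
    [p], although tangent vectors at [p] do not occur in its definition:
    positivity forces the Cauchy-Schwarz inequality. *)
Lemma met_at_eq0 p X Z : eq_at p X 0 -> g X Z p = 0.
Proof.
move=> /(met_eq0 g) X0.
pose b := g X Z p; pose c := g Z Z p.
have H t : 0 <= t * b * 2 + c.
  have := met_ge0 g (sfun_cst t *: X + Z) p.
  rewrite metDl !metDr !metZl !metZr (met_sym g Z X) !sfunE X0 -/b -/c /=.
  by lra.
have [//|b0] := eqVneq b 0.
(* the value of [t] that makes the affine function of [H] equal to -1 *)
have := H (- (c + 1) / (b * 2)).
have -> : - (c + 1) / (b * 2) * b * 2 + c = - 1 by field.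
by rewrite oppr_ge0 ler10.
Qed.

Lemma met_at p X Y Z : eq_at p X Y -> g X Z p = g Y Z p.
Proof.
move=> XY; apply/eqP; rewrite -subr_eq0 -sfunN -sfunD -metBl; apply/eqP.
by apply: met_at_eq0 => f; rewrite !secE !sfunE XY subrr.
Qed.

(** The algebra behind the uniqueness of the Levi-Civita connection: an
    expression [g (S X Y) Z] that is symmetric in [X, Y] and skew in [Y, Z]
    vanishes, as cycling the arguments three times changes its sign. *)
Lemma symmetric_skew_eq0 (S : vfield M -> vfield M -> vfield M) :
  (forall X Y, S X Y = S Y X) ->
  (forall X Y Z, g (S X Y) Z + g Y (S X Z) = 0) -> forall X Y, S X Y = 0.
Proof.
move=> Ssym Sskew X Y; apply: met_inj => Z; rewrite met0l; apply: sfun_eq => p.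
have E A B C : g (S A B) C p = - g (S A C) B p.
  by apply/eqP; rewrite -addr_eq0 -sfunD (met_sym g (S A C)) Sskew.
have := E X Y Z; rewrite (Ssym X Z) (E Z X Y) (Ssym Z Y) (E Y Z X) (Ssym Y X) sfunE => H.
by lra.
Qed.

Lemma levi_civita_unique D1 D2 :
  is_levi_civita g D1 -> is_levi_civita g D2 -> D1 = D2.
Proof.
move=> [_ t1 m1] [_ t2 m2]; apply/funext => X; apply/funext => Y.
apply/eqP; rewrite -subr_eq0; apply/eqP; move: X Y.
apply: symmetric_skew_eq0 => [X Y|X Y Z].
  apply/eqP; rewrite -subr_eq0.
  have -> : D1 X Y - D2 X Y - (D1 Y X - D2 Y X) =
    (D1 X Y - D1 Y X) - (D2 X Y - D2 Y X) by rewrite !opprD !opprK addrACA.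
  by rewrite t1 t2 subrr.
have := m1 X Y Z; have := m2 X Y Z; rewrite /cov_metric => e2 e1.
rewrite metBl metBr; apply: sfun_eq => p.
have := congr1 (fun f : smooth_fun M => f p) e1.
have := congr1 (fun f : smooth_fun M => f p) e2.
by rewrite !sfunE; lra.
Qed.

Lemma conjugate_unique D D1 D2 :
  is_conjugate g D D1 -> is_conjugate g D D2 -> D1 = D2.
Proof.
move=> [_ c1] [_ c2]; apply/funext => X; apply/funext => Y; apply: met_inj => Z.
rewrite !(met_sym g _ Z); apply: (addrI (g (D X Z) Y)).
by rewrite -c1 -c2.
Qed.

Lemma is_conjugate_sym D D' :
  is_connection D -> is_conjugate g D D' -> is_conjugate g D' D.
Proof.
move=> cD [_ c]; split=> // X Y Z.
by rewrite (met_sym g Y) c addrC (met_sym g Z) (met_sym g _ Y).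
Qed.

Lemma levi_civita_self_conjugate D : is_levi_civita g D -> is_conjugate g D D.
Proof.
move=> [cD _ mD]; split=> // X Y Z; have := mD X Y Z; rewrite /cov_metric.
by move/eqP; rewrite -addrA -opprD subr_eq0 => /eqP.
Qed.

(** This is where the Codazzi equation of a statistical structure is used. *)
Lemma conjugate_torsion_free D D' :
  is_statistical g D -> is_conjugate g D D' -> torsion_free D'.
Proof.
move=> [_ tD cod_D] [_ c] X Y; apply: met_inj => Z; rewrite -tD !metBl.
have := cod_D X Y Z; rewrite /cov_metric.
rewrite (met_sym g Y Z) (met_sym g X Z) !c.
rewrite (met_sym g _ Y) (met_sym g _ X) (met_sym g Z) (met_sym g Z (D' Y X)).
move=> e; apply: sfun_eq => p; have := congr1 (fun f : smooth_fun M => f p) e.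
by rewrite !sfunE; lra.
Qed.

(** [D + D' - 2 D0] is symmetric since the three connections are torsion-free,
    and skew since [D] and [D'] are conjugate. *)
Lemma K_tensor_conjugate D D' D0 : is_statistical g D ->
  is_conjugate g D D' -> is_levi_civita g D0 ->
  forall X Y, K_tensor D0 D' X Y = - K_tensor D0 D X Y.
Proof.
move=> sD cD' LC X Y; have [_ t0 _] := LC.
have t' := conjugate_torsion_free sD cD'; have [_ tD _] := sD.
have [_ c] := cD'; have [_ c0] := levi_civita_self_conjugate LC.
apply/eqP; rewrite -addr_eq0; apply/eqP; move: X Y.
apply: symmetric_skew_eq0 => [X Y|X Y Z]; rewrite /K_tensor.
  have E (B : affine_connection M) : torsion_free B -> B X Y = B Y X + bracket X Y.
    by move=> <-; rewrite addrC subrK.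
  rewrite (E D) // (E D') // (E D0) //.
  apply: sec_eq => f; rewrite !secE; apply: sfun_eq => p.
  by rewrite !sfunE; ring.
have := c X Y Z; have := c X Z Y; have := c0 X Y Z.
rewrite (met_sym g Z Y) => -> e1 e2.
rewrite metDl metDr !metBl !metBr; apply: sfun_eq => p.
have := congr1 (fun f : smooth_fun M => f p) e1.
have := congr1 (fun f : smooth_fun M => f p) e2.
rewrite (met_sym g (D X Z)) (met_sym g Z (D' X Y)) !sfunE; lra.
Qed.

End Metric.

(** * Curvature *)

Section Curvature.
Context {R : realType} {m : nat} {M : manifold R m}.
Implicit Types (f : smooth_fun M) (X Y Z W : vfield M) (p : M).

Section Connection.
Variable D : affine_connection M.
Hypothesis cD : is_connection D.

Lemma conDr X Y Z : D X (Y + Z) = D X Y + D X Z.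
Proof. by case: cD. Qed.
Lemma conZr f X Y : D X (f *: Y) = X f *: Y + f *: D X Y.
Proof. by case: cD. Qed.
Lemma conDl X Y Z : D (X + Y) Z = D X Z + D Y Z.
Proof. by case: cD => c _ _; have := c 1 X Y Z; rewrite !scale1r. Qed.
Lemma con0l Z : D 0 Z = 0.
Proof. by apply: (addrI (D 0 Z)); rewrite -conDl !addr0. Qed.
Lemma con0r Z : D Z 0 = 0.
Proof. by apply: (addrI (D Z 0)); rewrite -conDr !addr0. Qed.
Lemma conZl f X Z : D (f *: X) Z = f *: D X Z.
Proof. by case: cD => c _ _; have := c f X 0 Z; rewrite !addr0 con0l addr0. Qed.
Lemma conNl X Z : D (- X) Z = - D X Z.
Proof. by rewrite -scaleN1r conZl scaleN1r. Qed.
Lemma conBl X Y Z : D (X - Y) Z = D X Z - D Y Z.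
Proof. by rewrite conDl conNl. Qed.
Lemma conNr X Z : D X (- Z) = - D X Z.
Proof. by apply/eqP; rewrite -addr_eq0 -conDr addNr con0r. Qed.
Lemma conBr X Y Z : D X (Y - Z) = D X Y - D X Z.
Proof. by rewrite conDr conNr. Qed.
Lemma con_suml (I : Type) (r : seq I) (F : I -> vfield M) Z :
  D (\sum_(i <- r) F i) Z = \sum_(i <- r) D (F i) Z.
Proof. by elim/big_rec2: _ => [|i x y _ <-]; [exact: con0l|exact: conDl]. Qed.

Lemma curvatureC X Y Z : curvature D X Y Z = - curvature D Y X Z.
Proof.
rewrite /curvature (bracketC X) conNl opprK.
by apply: sec_eq => f; rewrite !secE; apply: sfun_eq => p; rewrite !sfunE; ring.
Qed.

Lemma curvature_linear1 f X X' Y Z :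
  curvature D (f *: X + X') Y Z = f *: curvature D X Y Z + curvature D X' Y Z.
Proof.
rewrite /curvature bracketDl bracketZl.
rewrite !conDl !conNl !conZl conDr conZr.
by apply: sec_eq => h; rewrite !secE; apply: sfun_eq => p; rewrite !sfunE; ring.
Qed.

Lemma curvature_linear2 f X Y Y' Z :
  curvature D X (f *: Y + Y') Z = f *: curvature D X Y Z + curvature D X Y' Z.
Proof.
by rewrite !(curvatureC X) curvature_linear1 opprD scalerN.
Qed.

Lemma curvature_linear3 f X Y Z Z' :
  curvature D X Y (f *: Z + Z') = f *: curvature D X Y Z + curvature D X Y Z'.
Proof.
rewrite /curvature !conDr !conZr !conDr !conZr /=.
by apply: sec_eq => h; rewrite !secE; apply: sfun_eq => p; rewrite !sfunE; ring.
Qed.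

Lemma bianchi X Y Z : torsion_free D ->
  curvature D X Y Z + curvature D Y Z X + curvature D Z X Y = 0.
Proof.
move=> tD.
(* without torsion, the cyclic sum is the Jacobi sum of iterated brackets *)
have <- : bracket X (bracket Y Z) + bracket Y (bracket Z X) +
          bracket Z (bracket X Y) = 0 by exact: jacobi.
rewrite /curvature -!tD !conBl !conBr.
by apply: sec_eq => h; rewrite !secE; apply: sfun_eq => p; rewrite !sfunE; ring.
Qed.

End Connection.

Section LeviCivita.
Variables (g : metric M) (D : affine_connection M).
Hypothesis LC : is_levi_civita g D.

Let cD : is_connection D. Proof. by case: LC. Qed.
Let tD : torsion_free D. Proof. by case: LC. Qed.
Let mD X Y Z : X (g Y Z) = g (D X Y) Z + g Y (D X Z).
Proof. by have [_] := levi_civita_self_conjugate LC; exact. Qed.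

Lemma curvature_skew X Y Z W :
  g (curvature D X Y Z) W = - g (curvature D X Y W) Z.
Proof.
have e := mD (bracket X Y) Z W.
have e1 : bracket X Y (g Z W) = X (Y (g Z W)) - Y (X (g Z W)) by [].
move: e; rewrite e1 !mD !secD !mD /curvature !metBl.
rewrite !(met_sym g Z) => e.
apply: sfun_eq => p; have := congr1 (fun f : smooth_fun M => f p) e.
by rewrite !sfunE; lra.
Qed.

Lemma curvature_pair_sym X Y Z W :
  g (curvature D X Y Z) W = g (curvature D Z W X) Y.
Proof.
(* the four cyclic identities on [X, Y, Z, W], with all terms reduced to six
   unknowns by the skew-symmetries, form a linear system implying the claim *)
pose r A B C E p := g (curvature D A B C) E p.
have r1 A B C E p : r A B C E p = - r B A C E p.
  by rewrite /r (curvatureC cD) metNl.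
have r2 A B C E p : r A B C E p = - r A B E C p.
  by rewrite /r curvature_skew.
have r3 A B C E p : r A B C E p + r B C A E p + r C A B E p = 0.
  by rewrite /r -!sfunD -!metDl (bianchi cD) // met0l.
apply: sfun_eq => p; rewrite -/(r X Y Z W p) -/(r Z W X Y p).
have := r3 X Y Z W p; rewrite (r1 Z X Y W) => h1.
have := r3 Y Z W X p; rewrite (r2 Y Z W X) (r2 Z W Y X) (r1 W Y Z X) (r2 Y W Z X) => h2.
have := r3 Z W X Y p; rewrite (r1 W X Z Y) (r2 X W Z Y) (r2 X Z W Y) => h3.
have := r3 W X Y Z p; rewrite (r1 W X Y Z) (r2 X Y W Z) => h4.
lra.
Qed.

End LeviCivita.
End Curvature.

(** * Locality *)

Section Locality.
Context {R : realType} {m : nat} {M : manifold R m}.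
Implicit Types (f : smooth_fun M) (X Y Z : vfield M) (U : set M).

(** Equality of two vector fields at all points of [U]. *)
Definition eq_on U X Y : Prop := forall p, U p -> eq_at p X Y.

Lemma eq_on_refl U X : eq_on U X X.
Proof. by []. Qed.

Lemma eq_on_trans U X Y Z : eq_on U X Y -> eq_on U Y Z -> eq_on U X Z.
Proof. by move=> XY YZ p Up f; rewrite (XY p Up) (YZ p Up). Qed.

Lemma eq_onD U X Y X' Y' : eq_on U X Y -> eq_on U X' Y' -> eq_on U (X + X') (Y + Y').
Proof. by move=> XY XY' p Up f; rewrite !secE !sfunE (XY p Up) (XY' p Up). Qed.

Lemma eq_onN U X Y : eq_on U X Y -> eq_on U (- X) (- Y).
Proof. by move=> XY p Up f; rewrite !secE !sfunE (XY p Up). Qed.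

Lemma eq_onZ U f (h : smooth_fun M) X Y : (forall p, U p -> f p = h p) -> eq_on U X Y ->
  eq_on U (f *: X) (h *: Y).
Proof. by move=> fh XY p Up k; rewrite !secE !sfunE (XY p Up) fh. Qed.

Lemma eq_on_sum U (I : Type) (r : seq I) (F G : I -> vfield M) :
  (forall i, eq_on U (F i) (G i)) ->
  eq_on U (\sum_(i <- r) F i) (\sum_(i <- r) G i).
Proof.
move=> FG; elim/big_rec2: _ => [|i x y _ xy]; first exact: eq_on_refl.
exact: eq_onD.
Qed.

Lemma eq_on_sub0 U X Y : eq_on U X Y -> eq_on U (X - Y) 0.
Proof. by move=> XY p Up f; rewrite !secE !sfunE (XY p Up) subrr. Qed.

(** A field that vanishes on [U] is killed by a function equal to 1 at [p]; this
    turns global algebraic rules into local statements. *)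
Lemma eq_on_bump U X p : open U -> U p -> eq_on U X 0 ->
  exists phi : smooth_fun M, phi p = 1 /\ phi *: X = 0.
Proof.
move=> oU Up X0; have [phi [phi1 phi0]] := exists_bump oU Up.
exists phi; split=> //; apply: sec_eq => f; apply: sfun_eq => q.
rewrite !secE !sfunE; have [Uq|/phi0->] := pselect (U q); last exact: mul0r.
by rewrite (X0 q Uq) sec0E sfun0 mulr0.
Qed.

Lemma linear_fun0 (F : vfield M -> vfield M) :
  (forall f Z Z', F (f *: Z + Z') = f *: F Z + F Z') -> F 0 = 0.
Proof. by move=> lF; apply: (addrI (F 0)); rewrite -{1}[F 0]scale1r -lF scale1r !addr0. Qed.

Lemma linear_funN (F : vfield M -> vfield M) X :
  (forall f Z Z', F (f *: Z + Z') = f *: F Z + F Z') -> F (- X) = - F X.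
Proof.
by move=> lF; rewrite -scaleN1r -[_ *: X]addr0 lF linear_fun0// addr0 scaleN1r.
Qed.

Lemma linear_funB (F : vfield M -> vfield M) X Y :
  (forall f Z Z', F (f *: Z + Z') = f *: F Z + F Z') -> F (X - Y) = F X - F Y.
Proof. by move=> lF; rewrite -[X]scale1r lF !scale1r linear_funN. Qed.

Lemma eq_on_linear U (F : vfield M -> vfield M) X Y : open U ->
  (forall f Z Z', F (f *: Z + Z') = f *: F Z + F Z') ->
  eq_on U X Y -> eq_on U (F X) (F Y).
Proof.
move=> oU lF /eq_on_sub0 XY p Up f.
have [phi [phi1 phiS]] := eq_on_bump oU Up XY.
have := lF phi (X - Y) 0; rewrite phiS addr0 linear_fun0// addr0 linear_funB//.
move=> /(congr1 (fun Z : vfield M => Z f p)).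
by rewrite !secE !sfunE phi1 mul1r => /esym/eqP; rewrite subr_eq0 => /eqP.
Qed.

Lemma eq_on_connection U (D : affine_connection M) Z X Y : open U ->
  is_connection D -> eq_on U X Y -> eq_on U (D Z X) (D Z Y).
Proof.
move=> oU cD /eq_on_sub0 XY p Up f.
have [phi [phi1 phiS]] := eq_on_bump oU Up XY.
have := conZr cD phi Z (X - Y); rewrite phiS (con0r cD).
move=> /(congr1 (fun Z : vfield M => Z f p)).
have := XY p Up f; rewrite (conBr cD) !secE !sfunE phi1 mul1r => ->.
by rewrite mulr0 add0r => /esym/eqP; rewrite subr_eq0 => /eqP.
Qed.

Lemma eq_on_connectionl U (D : affine_connection M) Z X Y : open U ->
  is_connection D -> eq_on U X Y -> eq_on U (D X Z) (D Y Z).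
Proof.
by move=> oU cD; apply: (eq_on_linear (F := D^~ Z)) => // f A B; case: cD => + _ _; exact.
Qed.

End Locality.

(** * Orthonormal frames and traces *)

Section Frames.
Context {R : realType} {m : nat} {M : manifold R m}.
Variables (g : metric M) (U : set M) (E : 'I_m -> vfield M).
Hypothesis oE : orthonormal_frame g U E.

Let oU : open U. Proof. by case: oE. Qed.

(** The coefficients in the frame, which are arbitrary numbers at each point in
    [orthonormal_frame], are those given by the metric. *)
Lemma frame_expansion (X : vfield M) : eq_on U X (\sum_i g X (E i) *: E i).
Proof.
move=> p Up; have [_ oEE /(_ X p Up)[a Xa]] := oE.
have aE i : g X (E i) p = a i.
  rewrite (met_at _ _ Xa) met_suml sfun_sum (bigD1 i)//= big1 ?addr0.
    by rewrite metZl sfunM oEE// eqxx mulr1.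
  by move=> j ji; rewrite metZl sfunM oEE// (negbTE ji) mulr0.
move=> f; rewrite Xa !sec_sum !sfun_sum; apply: eq_bigr => i _.
by rewrite !secE !sfunM aE.
Qed.

Lemma trace_unique (B : vfield M -> vfield M) (S S' : vfield M) :
  is_trace (u := id_map M) g B S -> is_trace (u := id_map M) g B S' -> eq_on U S S'.
Proof.
by move=> tS tS' p Up f; rewrite (tS U E oE p Up) (tS' U E oE p Up).
Qed.

Variable D : affine_connection M.
Hypothesis LC : is_levi_civita g D.

Lemma curvature_trace_ricci (T : vfield M) :
  eq_on U (\sum_i curvature D (E i) T (E i)) (- \sum_i ricci E g D (E i) T *: E i).
Proof.
apply: eq_on_trans (frame_expansion _) _.
rewrite -sumrN; apply: eq_on_sum => i; rewrite -scaleNr.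
apply: eq_onZ => // p _; congr (sfun _ p).
rewrite met_suml /ricci -sumrN; apply: eq_bigr => j _.
by rewrite (curvature_pair_sym LC) (curvature_skew LC).
Qed.

End Frames.

(** * Identification of the chosen objects *)

Section Choices.
Context {R : realType} {m : nat} {M : manifold R m}.
Variables (g : metric M) (D0 : affine_connection M).
Hypothesis LC : is_levi_civita g D0.

Lemma levi_civitaE : levi_civita g = D0.
Proof. by apply: xget_unique => // D' LC'; exact: levi_civita_unique LC' LC. Qed.

Lemma conjugateE D D' : is_conjugate g D D' -> conjugate g D = D'.
Proof. by move=> c; apply: xget_unique => // D'' c'; exact: conjugate_unique c' c. Qed.

Lemma induced_id (D : affine_connection M) :
  is_connection D -> induced (u := id_map M) D = D.
Proof.
move=> cD; apply: xget_unique => [|Du [_ [ext [_ e1 e2]]]].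
  split=> //; exists D; split=> [Y f X Z|Z Y|X Y].
  - by case: cD => + _ _; exact.
  - by rewrite !restr_id.
  - by rewrite restr_id push_id.
apply/funext => X; apply/funext => Y.
by rewrite -{1}(restr_id Y) e2 push_id -{1}(restr_id X) e1 restr_id.
Qed.

(** The dual tensor [L] exists here because the pair symmetry exhibits it. *)
Lemma L_tensor_levi_civita : L_tensor g D0 = curvature D0.
Proof.
apply: xget_unique => [X Y Z W|L' HL]; first exact/esym/curvature_pair_sym.
apply/funext => Z; apply/funext => W; apply/funext => X; apply: (@met_inj _ _ _ g) => Y.
by rewrite HL (curvature_pair_sym LC).
Qed.

Lemma pull3_curvature (D : affine_connection M) : is_connection D ->
  pull3 (u := id_map M) (curvature D) = curvature D.
Proof.
move=> cD.
apply: xget_unique => [|B [_ _ _ HB]].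
  split=> [t r f x y|s r f x y|s t f x y|X Y Z].
  - exact: curvature_linear1.
  - exact: curvature_linear2.
  - exact: curvature_linear3.
  - by rewrite !restr_id.
apply/funext => X; apply/funext => Y; apply/funext => Z.
by rewrite -{1}(restr_id X) -{1}(restr_id Y) -{1}(restr_id Z) HB restr_id.
Qed.

Lemma pull2_K_levi_civita X Y : pull2 (u := id_map M) (K_tensor D0 D0) X Y = 0.
Proof.
suff -> : pull2 (u := id_map M) (K_tensor D0 D0) = (fun _ _ => 0) by [].
have K0 A B : K_tensor D0 D0 A B = 0 by exact: subrr.
apply: xget_unique => [|B [_ _ HB]].
  split=> [t f x y|s f x y|A B]; rewrite ?scaler0 ?addr0//.
  by rewrite K0 restr_id.
apply/funext => A; apply/funext => C.
by rewrite -(restr_id A) -(restr_id C) HB K0 restr_id.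
Qed.

End Choices.

(** * The bi-tension field of the identity *)

Section BitensionIdentity.
Context {R : realType} {m : nat} {M : manifold R m}.
Variables (g : metric M) (D D' D0 : affine_connection M).
Hypothesis LC : is_levi_civita g D0.
Hypothesis conjD : is_conjugate g D D'.
Hypothesis sumD : forall X Y, K_tensor D0 D' X Y = - K_tensor D0 D X Y.
Variable T : vfield M.
Hypothesis trT : is_tchebychev g D0 D T.
Variables (U : set M) (E : 'I_m -> vfield M).
Hypothesis oE : orthonormal_frame g U E.

Let oU : open U. Proof. by case: oE. Qed.
Let cD0 : is_connection D0. Proof. by case: LC. Qed.

Lemma tension_id : eq_on U (tension (id_map M) g D D0) (- T).
Proof.
have trNT : is_trace (u := id_map M) g
    (fun X => induced (u := id_map M) D0 X (push X) - push (D X X)) (- T).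
  move=> V F oF p Vp f; rewrite secNE sfunN (trT oF Vp).
  rewrite !sec_sum !sfun_sum -sumrN; apply: eq_bigr => i _.
  by rewrite induced_id// !push_id /K_tensor !secE !sfunE; ring.
exact: (trace_unique oE (xgetI 0 trNT) trNT).
Qed.

Lemma tchebychev_on : eq_on U (tchebychev g D0 D) T.
Proof. exact: (trace_unique oE (xgetI 0 trT) trT). Qed.

Lemma laplacian_connection (S : vfield M) :
  laplacian (u := id_map M) E D0 D' S =
  laplacian (u := id_map M) E D0 D0 S + D0 (\sum_i K_tensor D0 D (E i) (E i)) S.
Proof.
rewrite (con_suml cD0) /laplacian -big_split /=; apply: eq_bigr => i _.
have -> : D' (E i) (E i) = D0 (E i) (E i) - K_tensor D0 D (E i) (E i).
  by rewrite -sumD /K_tensor addrC subrK.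
by rewrite (conBl cD0) opprB addrA addrAC.
Qed.

Lemma laplacianN (S : vfield M) :
  laplacian (u := id_map M) E D0 D0 (- S) = - laplacian (u := id_map M) E D0 D0 S.
Proof.
rewrite /laplacian -sumrN; apply: eq_bigr => i _.
by rewrite !(conNr cD0) opprB opprK addrC.
Qed.

(** Both connections of the theorem fall under this formula, as the hypotheses
    of the section are symmetric under exchanging [D] with [D'] and [T] with
    [- T]. *)
Lemma bitension_id : eq_on U (bitension (id_map M) g D g D0 E)
  (- (laplacian (u := id_map M) E D0 D0 T + \sum_i ricci E g D0 (E i) T *: E i)
   - (divergence E g D0 T *: T + D0 T T)).
Proof.
rewrite /bitension.
rewrite (levi_civitaE LC) (conjugateE (levi_civita_self_conjugate LC)).
rewrite (conjugateE conjD) (induced_id cD0) (L_tensor_levi_civita LC).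
rewrite (pull3_curvature cD0) pull2_K_levi_civita subr0.
under eq_bigr do rewrite push_id.
set tau := tension _ _ _ _.
have tauT : eq_on U tau (- T) := tension_id.
have lapE : eq_on U (laplacian (u := id_map M) E D0 D' tau)
    (- laplacian (u := id_map M) E D0 D0 T - D0 T T).
  rewrite laplacian_connection -laplacianN -(conNr cD0).
  apply: eq_onD.
    apply: eq_on_sum => i; apply: eq_onD; last apply: eq_onN.
      by do 2 (apply: eq_on_connection => //).
    exact: eq_on_connection.
  apply: eq_on_trans (eq_on_connection _ oU cD0 tauT) _.
  apply: eq_on_connectionl => // p Up f.
  by rewrite (trT oE Up).
have divE : eq_on U (divergence E g D0 (tchebychev g D0 D) *: tau)
    (- (divergence E g D0 T *: T)).
  rewrite -scalerN; apply: eq_onZ => // p Up.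
  rewrite /divergence !sfun_sum; apply: eq_bigr => i _.
  by apply: met_at; apply: (eq_on_connection _ oU cD0 tchebychev_on).
have ricE : eq_on U (- \sum_i curvature D0 (E i) tau (E i))
    (- \sum_i ricci E g D0 (E i) T *: E i).
  apply: eq_on_trans (curvature_trace_ricci oE LC T).
  rewrite -sumrN; apply: eq_on_sum => i.
  have -> : curvature D0 (E i) T (E i) = - curvature D0 (E i) (- T) (E i).
    rewrite (linear_funN (F := fun Y => curvature D0 (E i) Y (E i))) ?opprK//.
    by move=> f A B; exact: curvature_linear2.
  apply: eq_onN.
  apply: (eq_on_linear (F := fun Y => curvature D0 (E i) Y (E i))) => //.
  by move=> f A B; exact: curvature_linear2.
apply: eq_on_trans (eq_onD (eq_onD lapE divE) ricE) _.
move=> p Up f; rewrite !secE !sfunE; lra.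
Qed.

End BitensionIdentity.

(** * The characterization *)

Theorem theorem3p1 (R : realType) (m : nat) (hm : (2 <= m)%N)
  (M : manifold R m) (hM : orientable M) (g : metric M)
  (D Dbar Dg : affine_connection M)
  (hD : is_statistical g D)
  (hDbar : is_conjugate g D Dbar)
  (hDg : is_levi_civita g Dg)
  (T : vfield M) (hT : is_tchebychev g Dg D T) :
  (vanishes g (bitension (id_map M) g D g Dg) /\
   vanishes g (bitension (id_map M) g Dbar g Dg))
  <->
  (vanishes g (fun E => laplacian E Dg Dg T
                        + \sum_(i < m) ricci E g Dg (E i) T *: E i) /\
   vanishes g (fun E => divergence E g Dg T *: T + Dg T T)).
Proof.
have [cD _ _] := hD; have [cDbar _] := hDbar; have [cDg _ _] := hDg.
have KE := K_tensor_conjugate hD hDbar hDg.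
have KE' X Y : K_tensor Dg D X Y = - K_tensor Dg Dbar X Y by rewrite KE opprK.
(* the second bi-tension field is that of the pair [(Dbar, - T)] *)
have hT' : is_tchebychev g Dg Dbar (- T).
  move=> U E oE p Up f; rewrite secNE sfunN (hT U E oE p Up).
  by rewrite !sec_sum !sfun_sum -sumrN; apply: eq_bigr => i _; rewrite KE.
pose A E : vfield M := laplacian (u := id_map M) E Dg Dg T
  + \sum_(i < m) ricci E g Dg (E i) T *: E i.
pose B E : vfield M := divergence E g Dg T *: T + Dg T T.
have tau1 U E : orthonormal_frame g U E ->
    eq_on U (bitension (id_map M) g D g Dg E) (- A E - B E).
  by move=> oE; exact: (bitension_id hDg hDbar KE hT oE).
have tau2 U E : orthonormal_frame g U E ->
    eq_on U (bitension (id_map M) g Dbar g Dg E) (A E - B E).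
  move=> oE.
  have := bitension_id hDg (is_conjugate_sym cD hDbar) KE' hT' oE.
  congr (eq_on _ _ (_ - _)); rewrite ?opprD.
    rewrite (laplacianN hDg) opprK; congr (_ + _); rewrite -sumrN.
    apply: eq_bigr => i _; rewrite -scaleNr; congr (_ *: _).
    rewrite /ricci -sumrN; apply: eq_bigr => j _.
    rewrite (linear_funN (F := curvature Dg (E j) (E i))) ?metNl ?opprK//.
    by move=> f Z Z'; exact: curvature_linear3.
  rewrite /B (conNr cDg) (conNl cDg) opprK; congr (_ + _).
  rewrite scalerN -scaleNr; congr (_ *: _).
  by rewrite /divergence -sumrN; apply: eq_bigr => i _; rewrite (conNr cDg) metNl opprK.
split=> -[H1 H2]; split=> U E oE p Up f.
- have := H1 U E oE p Up f; have := H2 U E oE p Up f.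
  rewrite (tau1 U E oE p Up) (tau2 U E oE p Up) -/(A E) !secE !sfunE; lra.
- have := H1 U E oE p Up f; have := H2 U E oE p Up f.
  rewrite (tau1 U E oE p Up) (tau2 U E oE p Up) -/(B E) !secE !sfunE; lra.
- rewrite (tau1 U E oE p Up); have := H1 U E oE p Up f; have := H2 U E oE p Up f.
  rewrite -/(A E) -/(B E) !secE !sfunE; lra.
- rewrite (tau2 U E oE p Up); have := H1 U E oE p Up f; have := H2 U E oE p Up f.
  rewrite -/(A E) -/(B E) !secE !sfunE; lra.
Qed.
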